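(* Let $X$ be a finite metric space and let $k\ge 0$ be an integer. For every element $(s,[x])$ of $\Gamma_k(X)$ there is a unique largest layer point $(t,[y])$ such that $(t,[y])\le(s,[x])$. In this case, $[y]_t=[x]_s$ as subsets of $X$.
   Context: For a finite metric space $(X,d)$, an integer $k\ge 0$ and $s\in[0,\infty]$, the degree Rips complex $L_{s,k}(X)$ is the simplicial complex whose simplices are the non-empty subsets $\tau\subset X$ such that $d(x,x')\le s$ for all $x,x'\in\tau$ and each $x\in\tau$ has at least $k$ distinct neighbours $y\in X$ (with $y\neq x$) such that $d(x,y)\le s$. For $s\le t$ there is an inclusion $L_{s,k}(X)\subset L_{t,k}(X)$. For a vertex $x$ of $L_{s,k}(X)$, $[x]$ or $[x]_s$ denotes its path component, regarded both as an element of $\pi_0L_{s,k}(X)$ and as a subset of $X$ (the set of vertices in that component). The poset $\Gamma_k(X)$ has elements the pairs $(s,[x])$ with $s\in[0,\infty]$ and $[x]\in\pi_0L_{s,k}(X)$, with $(s,[x])\le(t,[y])$ if and only if $s\le t$ and $[x]=[y]$ in $\pi_0L_{t,k}(X)$ (equivalently $s\le t$ and $[x]_s\subset[y]_t$). A layer point of $\Gamma_k(X)$ is an element $(t,[x])$ such that either 1) whenever $(s,[y])\le(t,[x])$ with $s<t$, the set $[y]_s$ is a proper subset of $[x]_t$, or 2) there is no relation $(s,[y])\le(t,[x])$ with $s<t$. The largest layer point below $(s,[x])$ means a layer point $(t,[y])\le(s,[x])$ such that $(u,[z])\le(t,[y])$ for every layer point $(u,[z])\le(s,[x])$. *)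

(* Defs.v *)
From HB Require Import structures.
From mathcomp Require Import all_boot all_order all_algebra.
From mathcomp Require Import all_classical all_reals all_analysis.
(* [classical_sets] shadows [set0], [subsetP], etc. *)
From mathcomp Require Import fintype finset.

Set Implicit Arguments.
Unset Strict Implicit.
Unset Printing Implicit Defensive.

Import Order.TTheory GRing.Theory Num.Theory.
Local Open Scope ring_scope.

#[short(type="finMetricType")]
HB.structure Definition FinMetric (R : numDomainType) :=
  { X of Metric R X & Finite X }.

(* A simplicial complex with vertices in [X] is given by its set of simplices.
   Its path components are those of the graph of its edges, each one being
   represented by its set of vertices; [component K x] is only meaningful when
   [x] is a vertex of [K]. *)
Section Components.
Variable X : finType.
Implicit Types (K : {set {set X}}) (x : X).

Definition vertices K : {set X} := [set x | [set x] \in K].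

Definition component K x : {set X} :=
  [set y | connect [rel u v | [set u; v] \in K] x y].

Definition pi0 K : {set {set X}} := [set component K x | x in vertices K].

End Components.

Section DegreeRips.
Variables (R : realType) (X : finMetricType R).
Implicit Types (s t : \bar R) (k : nat) (x y : X).

Definition neighbours s x : {set X} :=
  [set y | (y != x) && ((mdist x y)%:E <= s)%E].

Definition degree_rips s k : {set {set X}} :=
  [set tau : {set X} |
    [&& tau != set0,
        [forall x in tau, forall y in tau, ((mdist x y)%:E <= s)%E] &
        [forall x in tau, (k <= #|neighbours s x|)%N]]].

Lemma sub_neighbours s t x : (s <= t)%E -> neighbours s x \subset neighbours t x.
Proof.
move=> st; apply/subsetP => y; rewrite !inE => /andP[-> /=].
by move/le_trans; apply.
Qed.

Lemma sub_degree_rips s t k :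
  (s <= t)%E -> degree_rips s k \subset degree_rips t k.
Proof.
move=> st; apply/subsetP => tau.
rewrite !inE => /and3P[-> /forall_inP ds /forall_inP ks]; apply/andP; split=> //.
apply/andP; split.
  apply/forall_inP => x xt; apply/forall_inP => y yt.
  by apply: le_trans st; move/forall_inP: (ds x xt); apply.
apply/forall_inP => x xt; apply: leq_trans (ks x xt) _.
exact/subset_leq_card/sub_neighbours.
Qed.

Lemma mem_component (K : {set {set X}}) x : x \in component K x.
Proof. by rewrite inE connect0. Qed.

Lemma component_eq (K : {set {set X}}) x y :
  y \in component K x -> component K y = component K x.
Proof.
rewrite inE => xy; apply/setP => z; rewrite !inE.
have sym : connect_sym [rel u v : X | [set u; v] \in K].
  by apply: sym_connect_sym => u v /=; rewrite setUC.
by rewrite (same_connect sym xy).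
Qed.

Lemma sub_component s t k x : (s <= t)%E ->
  component (degree_rips s k) x \subset component (degree_rips t k) x.
Proof.
move=> st; apply/subsetP => y; rewrite !inE.
apply: connect_sub => u v uv; apply: connect1.
exact: (subsetP (sub_degree_rips k st)).
Qed.

End DegreeRips.

Section Gamma.
Variables (R : realType) (X : finMetricType R) (k : nat).

Record Gamma := MkGamma {
  gamma_val : \bar R * {set X};
  gamma_valP : (0 <= gamma_val.1)%E &&
               (gamma_val.2 \in pi0 (degree_rips X gamma_val.1 k))
}.

HB.instance Definition _ := [isSub for gamma_val].
HB.instance Definition _ := [Choice of Gamma by <:].

Implicit Types g h l : Gamma.

Definition scale g : \bar R := (gamma_val g).1.
Definition block g : {set X} := (gamma_val g).2.

(* The class of [g] maps to that of [h] in pi0 at the scale of [h]; the choice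
   of the representative [x] of [block g] does not matter. *)
Definition gamma_le g h : bool :=
  (scale g <= scale h)%E &&
  [exists x in block g, component (degree_rips X (scale h) k) x == block h].

Lemma block_component g x : x \in block g ->
  component (degree_rips X (scale g) k) x = block g.
Proof.
case: g => [[s C] /= sC]; rewrite /block /scale /=.
by case/andP: sC => _ /imsetP[y _ /= ->]; exact: component_eq.
Qed.

Lemma block_neq0 g : exists x, x \in block g.
Proof.
case: g => [[s C] /= sC]; rewrite /block /=.
case/andP: sC => _ /imsetP[y _ /= ->]; exists y; exact: mem_component.
Qed.

Lemma gamma_leE g h :
  gamma_le g h = (scale g <= scale h)%E && (block g \subset block h).
Proof.
rewrite /gamma_le; case: leP => //= gh; apply/exists_inP/idP.
  case=> x xg /eqP <-; rewrite -(block_component xg); exact: sub_component.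
case: (block_neq0 g) => x xg /subsetP/(_ x xg) xh; exists x => //.
by rewrite block_component.
Qed.

Lemma gamma_le_refl : reflexive gamma_le.
Proof. by move=> g; rewrite gamma_leE lexx /=. Qed.

Lemma gamma_le_anti : antisymmetric gamma_le.
Proof.
move=> g h; rewrite !gamma_leE => /andP[/andP[gh sgh] /andP[hg shg]].
apply/val_inj; rewrite /= [LHS]surjective_pairing [RHS]surjective_pairing.
congr pair; first by apply/le_anti/andP.
by apply/eqP; rewrite eqEsubset; apply/andP.
Qed.

Lemma gamma_le_trans : transitive gamma_le.
Proof.
move=> h g l; rewrite !gamma_leE => /andP[gh sgh] /andP[hl shl].
by rewrite (le_trans gh hl) (subset_trans sgh shl).
Qed.

Fact gamma_display : Order.disp_t. Proof. exact: Order.Disp tt tt. Qed.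

HB.instance Definition _ := Order.Le_isPOrder.Build gamma_display Gamma
  gamma_le_refl gamma_le_anti gamma_le_trans.

Definition layer_point g : Prop :=
  (forall h, (h <= g)%O -> (scale h < scale g)%E -> block h \proper block g) \/
  ~ (exists h, (h <= g)%O /\ (scale h < scale g)%E).

Definition largest_layer_point_below g h : Prop :=
  [/\ layer_point h, (h <= g)%O &
      forall l, layer_point l -> (l <= g)%O -> (l <= h)%O].

End Gamma.

(* Main.v *)
Require Import Defs.
From mathcomp Require Import all_boot all_order all_algebra.
From mathcomp Require Import all_classical all_reals all_analysis.
(* [classical_sets] shadows the notions on finite sets. *)
From mathcomp Require Import fintype finset.

(** Fix [g] and look at the scales at which the set [block g] is a path
    component.  A degree Rips complex changes only when the scale passes a
    distance between two points of [X], and these are finitely many, so going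
    down from any scale to the last such distance (or to [0]) does not change
    the complex ([degree_rips_scale_floor]).  Hence the scales at which
    [block g] is a component have a least element, and not only an infimum
    ([exists_first_scale]).

    The element [h] that has the block of [g] and this least scale is the
    answer.  It is a layer point, because an element strictly earlier below [h]
    has a block contained in that of [h] and, by minimality, different from it.
    It is above every layer point [l] below [g]: if [l] came strictly later
    than [h], then the block of [l], squeezed between [block h] and [block g],
    would equal [block h] ([block_sandwich]), so that [block l] would already
    have appeared earlier below [l], which a layer point forbids. *)

Set Implicit Arguments.
Unset Strict Implicit.
Unset Printing Implicit Defensive.

Import Order.TTheory GRing.Theory Num.Theory.
Local Open Scope ereal_scope.

Section CriticalScales.
Variables (R : realType) (X : finMetricType R).
Implicit Types (s t : \bar R) (k : nat) (A : {set X * X}).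

Lemma degree_rips_ext s t k :
    (forall x y : X, ((mdist x y)%:E <= s) = ((mdist x y)%:E <= t)) ->
  degree_rips X s k = degree_rips X t k.
Proof.
move=> st.
have nb (x : X) : neighbours s x = neighbours t x.
  by apply/setP => y; rewrite !inE st.
apply/setP => tau; rewrite !inE; congr [&& _, _ & _].
  by apply: eq_forallb_in => x _; apply: eq_forallb_in => y _; rewrite st.
by apply: eq_forallb_in => x _; rewrite nb.
Qed.

(** Indexing by sets of pairs makes the possible values a family over a finite
    type; the bottom value [0] is the least admissible scale. *)
Definition max_dist A : \bar R :=
  \big[Order.max/0]_(p in A) (mdist p.1 p.2)%:E.

Definition close_pairs s : {set X * X} := [set p | (mdist p.1 p.2)%:E <= s].

Definition scale_floor s : \bar R := max_dist (close_pairs s).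

Lemma max_dist_ge0 A : 0 <= max_dist A.
Proof.
apply: (big_ind (fun a : \bar R => 0 <= a)) => // [a b | p _].
  by rewrite le_max => ->.
by rewrite lee_fin mdist_ge0.
Qed.

Lemma scale_floor_le s : 0 <= s -> scale_floor s <= s.
Proof.
move=> s0; apply: (big_ind (fun a : \bar R => a <= s)) => // [a b | p].
  by rewrite ge_max => -> ->.
by rewrite inE.
Qed.

Lemma degree_rips_scale_floor s k :
  0 <= s -> degree_rips X (scale_floor s) k = degree_rips X s k.
Proof.
move=> s0; apply: degree_rips_ext => x y; apply/idP/idP.
  by move/le_trans; apply; exact: scale_floor_le.
move=> xys; rewrite /scale_floor /max_dist (bigD1 (x, y)) ?inE //=.
by rewrite le_max lexx.
Qed.

End CriticalScales.

Section LayerPoints.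
Variables (R : realType) (X : finMetricType R) (k : nat).
Implicit Types g h l : Gamma X k.

Lemma exists_first_scale g :
  exists2 h : Gamma X k, block h = block g &
    forall l, block l = block g -> scale h <= scale l.
Proof.
pose P (A : {set X * X}) := block g \in pi0 (degree_rips X (max_dist A) k).
have floorP l : block l = block g -> P (close_pairs X (scale l)).
  move=> lg; case/andP: (gamma_valP l) => s0.
  by rewrite /P -/(scale_floor X (scale l)) degree_rips_scale_floor // -lg.
case: (@Order.TotalTheory.arg_minP _ _ _ (close_pairs X (scale g)) P
         (@max_dist R X) (floorP g erefl)) => A PA minA.
have hP : (0 <= (max_dist A, block g).1) &&
    ((max_dist A, block g).2 \in pi0 (degree_rips X (max_dist A, block g).1 k)).
  by rewrite /= max_dist_ge0.
exists (MkGamma hP) => // l lg.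
apply: le_trans (minA _ (floorP l lg)) _.
by case/andP: (gamma_valP l) => s0 _; exact: scale_floor_le.
Qed.

(** The blocks at the scale of [l] are disjoint and each block at an earlier
    scale lies in one of them, so [block h], which meets [block l], is
    contained in it. *)
Lemma block_sandwich h l :
  scale h <= scale l -> block l \subset block h -> block l = block h.
Proof.
move=> hl lh; apply/eqP; rewrite eqEsubset lh /=.
have [x xl] := block_neq0 l.
rewrite -(block_component xl) -(block_component (subsetP lh _ xl)).
exact: sub_component.
Qed.

Lemma layer_point_proper h l :
  layer_point l -> (h <= l)%O -> scale h < scale l -> block h \proper block l.
Proof. by case=> [Pl|nl] hl lt_hl; [exact: Pl | case: nl; exists h]. Qed.

Lemma exists_largest_layer_point g :
  exists2 h : Gamma X k, largest_layer_point_below g h & block h = block g.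
Proof.
have [h hg minh] := exists_first_scale g; exists h => //; split.
- left=> l; rewrite [(l <= h)%O]gamma_leE => /andP[_ lh] lt_lh.
  rewrite properEneq lh andbT; apply: contraTneq lt_lh => eq_lh.
  by rewrite -leNgt minh // eq_lh.
- by rewrite [(h <= g)%O]gamma_leE hg subxx minh.
- move=> l layl; rewrite [(l <= g)%O]gamma_leE => /andP[_]; rewrite -hg => lh.
  rewrite [(l <= h)%O]gamma_leE lh andbT leNgt; apply/negP => lt_hl.
  have eq_lh := block_sandwich (ltW lt_hl) lh.
  have hl : (h <= l)%O by rewrite [(h <= l)%O]gamma_leE ltW // eq_lh subxx.
  by have := layer_point_proper layl hl lt_hl; rewrite eq_lh properxx.
Qed.

Lemma largest_layer_point_unique g h l :
  largest_layer_point_below g h -> largest_layer_point_below g l -> h = l.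
Proof.
move=> [layh hg maxh] [layl lg maxl].
by apply/le_anti; rewrite maxl ?maxh.
Qed.

End LayerPoints.

Theorem lemma5 (R : realType) (X : finMetricType R) (k : nat) (g : Gamma X k) :
  (exists! h : Gamma X k, largest_layer_point_below g h) /\
  (forall h : Gamma X k, largest_layer_point_below g h -> block h = block g).
Proof.
have [h maxh hg] := exists_largest_layer_point g; split.
  by exists h; split=> // l; exact: largest_layer_point_unique.
by move=> l maxl; rewrite (largest_layer_point_unique maxl maxh).
Qed.
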